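(* Let $m \in \{0,\ldots,M-1\}$ and let $\vec X^m \in \underline{V}^h$ with $\vec X^m(q_j) \in H$ for $j=1,\ldots,J$ and $|\vec X^m_\rho| > 0$ for almost all $\rho \in I$. Let $(\vec X^{m+1}, \kappa_g^{m+1}) \in \underline{V}^h \times V^h$, with $\vec X^{m+1}(q_j) \in H$ for $j=1,\ldots,J$, be a solution of the scheme $(\mathcal F_{m,\star})^h$: $$\left(g(\vec X^m)\,\frac{\vec X^{m+1} - \vec X^m}{\Delta t_m}, \chi\,\vec\nu^m\,|\vec X^m_\rho|\right)^h = \left(g^{-\frac12}(\vec X^m)\,[\kappa_g^{m+1}]_\rho, \chi_\rho\,|\vec X^m_\rho|^{-1}\right)^h \qquad \forall\ \chi \in V^h ,$$ $$\left(g(\vec X^m)\,\kappa_g^{m+1}\,\vec\nu^m, \vec\eta\,|\vec X^m_\rho|\right)^h + \left( \nabla\,[g^{\frac12}_+(\vec X^{m+1}) + g^{\frac12}_-(\vec X^m)], \vec\eta\, |\vec X^{m+1}_\rho| \right)^h + \left( g^{\frac12}(\vec X^m)\, \vec X^{m+1}_\rho,\vec\eta_\rho\, |\vec X^m_\rho|^{-1} \right)^h = 0 \qquad \forall\ \vec\eta \in \underline{V}^h .$$ Then $$L_g^h(\vec X^{m+1}) + \Delta t_m \left(g^{-\frac12}(\vec X^m)\,|[\kappa_g^{m+1}]_\rho|^2, |\vec X^m_\rho|^{-1}\right)^h \leq L_g^h(\vec X^m) .$$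
   Context: Let $H \subset \mathbb R^2$ be open and $g : H \to \mathbb R_{>0}$ a smooth function. It is assumed that $g^{\frac12}$ is split as $g^{\frac12} = g^{\frac12}_+ + g^{\frac12}_-$ with differentiable functions $g^{\frac12}_\pm : H \to \mathbb R$ such that $\pm g^{\frac12}_\pm$ is convex on $H$; here a differentiable $f : H \to \mathbb R$ is called convex on $H$ if $f(\vec u) \geq f(\vec v) + \nabla f(\vec v)\cdot(\vec u - \vec v)$ for all $\vec u,\vec v \in H$ (the usual notion when $H$ is convex). The expression $\nabla\,[g^{\frac12}_+(\vec X^{m+1}) + g^{\frac12}_-(\vec X^m)]$ means $(\nabla g^{\frac12}_+)(\vec X^{m+1}) + (\nabla g^{\frac12}_-)(\vec X^m)$. Let $I = \mathbb R/\mathbb Z$ be the periodic unit interval, $J \geq 3$, $h = J^{-1}$, $q_j = j\,h$ for $j=0,\ldots,J$ (with $q_0=0$ and $q_J=1$ identified) and $I_j = [q_{j-1},q_j]$, $j=1,\ldots,J$. Let $V^h = \{\chi \in C(I) : \chi|_{I_j} \text{ is linear for } j=1,\ldots,J\}$ and $\underline{V}^h = [V^h]^2$. Subscript $\rho$ (also $[\cdot]_\rho$) denotes the derivative with respect to the variable $\rho \in I$. For piecewise continuous functions $u,v$ with possible jumps at the nodes $q_j$, the mass lumped inner product is $$(u,v)^h = \tfrac12 \sum_{j=1}^J h \left[ (u\,v)(q_j^-) + (u\,v)(q_{j-1}^+) \right], \qquad u(q_j^\pm) = \lim_{\delta\searrow0} u(q_j\pm\delta).$$ It extends naturally to vector-valued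 functions, using the Euclidean dot product. Time steps: $0=t_0<t_1<\dots<t_M=T$ and $\Delta t_m = t_{m+1}-t_m > 0$. For $\vec X^m \in \underline{V}^h$ with $|\vec X^m_\rho|>0$ almost everywhere, $\vec\nu^m = - [\vec X^m_\rho]^\perp / |\vec X^m_\rho|$ (a piecewise constant unit normal), where $\cdot^\perp$ is clockwise rotation by $\frac\pi2$, i.e. $(a,b)^\perp = (b,-a)$. For $\vec Z \in \underline{V}^h$ with nodal values in $H$, the discrete length is $L_g^h(\vec Z) = \left( g^{\frac12}(\vec Z), |\vec Z_\rho| \right)^h$. *)

(* Defs.v *)
From HB Require Import structures.
From mathcomp Require Import all_boot all_order all_algebra.
From mathcomp Require Import all_classical all_reals all_analysis.

Set Implicit Arguments.
Unset Strict Implicit.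
Unset Printing Implicit Defensive.

Import Order.TTheory GRing.Theory Num.Theory.
Import numFieldNormedType.Exports.

Local Open Scope classical_set_scope.
Local Open Scope ring_scope.

(* The norm that the library puts on 'rV[R]_2 is the max norm; it only provides
   the topology here.  Lengths and products of vectors are the Euclidean ones. *)
Definition edot (R : realType) (u v : 'rV[R]_2) : R :=
  \sum_(i < 2) u 0 i * v 0 i.

Definition enorm (R : realType) (u : 'rV[R]_2) : R := Num.sqrt (edot u u).

(* clockwise rotation by pi/2: (a, b)^perp = (b, -a) *)
Definition perp (R : realType) (u : 'rV[R]_2) : 'rV[R]_2 :=
  \row_(i < 2) if i == 0 then u 0 1 else - u 0 0.

Definition grad (R : realType) (f : 'rV[R]_2 -> R) (z : 'rV[R]_2) : 'rV[R]_2 :=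
  \row_(i < 2) 'D_(delta_mx 0 i) f z.

(* Functions on the open set H are represented by total functions, of which
   only the values on H matter. *)
Fixpoint Ck_on (R : realType) (H : set 'rV[R]_2) (k : nat)
    (f : 'rV[R]_2 -> R) : Prop :=
  if k is k'.+1 then
    (forall z, H z -> differentiable f z) /\
    (forall i : 'I_2, Ck_on H k' (fun z => grad f z 0 i))
  else forall z, H z -> {for z, continuous f}.

Definition smooth_on (R : realType) (H : set 'rV[R]_2) (f : 'rV[R]_2 -> R) :=
  forall k, Ck_on H k f.

(* H need not be a convex set *)
Definition convex_on (R : realType) (H : set 'rV[R]_2) (f : 'rV[R]_2 -> R) :=
  forall u v, H u -> H v -> f v + edot (grad f v) (u - v) <= f u.

(* Functions on I = R/Z are represented by 1-periodic functions on R, so that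
   the node q_0 = q_J has neighbourhoods on both sides. *)
Definition node (R : realType) (J j : nat) : R := j%:R / J%:R.

Definition Vh (R : realType) (J : nat) (chi : R -> R) : Prop :=
  [/\ periodic chi 1, continuous chi &
      forall j, (j < J)%N -> exists a b : R,
        {in `[node R J j, node R J j.+1], forall x, chi x = a + b * x}].

Definition Vh2 (R : realType) (J : nat) (X : R -> 'rV[R]_2) : Prop :=
  forall i : 'I_2, Vh J (fun x => X x 0 i).

Definition lumped (R : realType) (J : nat) (w : R -> R) : R :=
  2^-1 * \sum_(j < J) J%:R^-1 *
    (lim (w x @[x --> (node R J j.+1)^'-]) + lim (w x @[x --> (node R J j)^'+])).

Definition mlip (R : realType) (J : nat) (u v : R -> R) : R :=
  lumped J (fun x => u x * v x).

Definition mlipv (R : realType) (J : nat) (u v : R -> 'rV[R]_2) : R :=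
  lumped J (fun x => edot (u x) (v x)).

(* |X_rho|; the value of derive1 X at the nodes, where X need not be
   differentiable, is never seen by the one-sided limits in [lumped] *)
Definition speed (R : realType) (X : R -> 'rV[R]_2) (x : R) : R :=
  enorm (derive1 X x).

Definition normal (R : realType) (X : R -> 'rV[R]_2) (x : R) : 'rV[R]_2 :=
  - ((speed X x)^-1 *: perp (derive1 X x)).

Definition Lgh (R : realType) (J : nat) (g : 'rV[R]_2 -> R)
    (Z : R -> 'rV[R]_2) : R :=
  mlip J (fun x => Num.sqrt (g (Z x))) (speed Z).

(* The two equations of the scheme, with dt the time step, X0 = X^m,
   X1 = X^{m+1}, kappa = kappa_g^{m+1}, and gp + gm the splitting of sqrt g. *)
Definition scheme_motion (R : realType) (J : nat) (g : 'rV[R]_2 -> R) (dt : R)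
    (X0 X1 : R -> 'rV[R]_2) (kappa : R -> R) : Prop :=
  forall chi : R -> R, Vh J chi ->
    mlipv J (fun x => g (X0 x) *: (dt^-1 *: (X1 x - X0 x)))
            (fun x => (chi x * speed X0 x) *: normal X0 x)
    = mlip J (fun x => (Num.sqrt (g (X0 x)))^-1 * derive1 kappa x)
             (fun x => derive1 chi x * (speed X0 x)^-1).

Definition scheme_curvature (R : realType) (J : nat)
    (g gp gm : 'rV[R]_2 -> R) (X0 X1 : R -> 'rV[R]_2) (kappa : R -> R) : Prop :=
  forall eta : R -> 'rV[R]_2, Vh2 J eta ->
    mlipv J (fun x => (g (X0 x) * kappa x) *: normal X0 x)
            (fun x => speed X0 x *: eta x)
    + mlipv J (fun x => grad gp (X1 x) + grad gm (X0 x))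
              (fun x => speed X1 x *: eta x)
    + mlipv J (fun x => Num.sqrt (g (X0 x)) *: derive1 X1 x)
              (fun x => (speed X0 x)^-1 *: derive1 eta x)
    = 0.

(* Main.v *)
Require Import Defs.
From HB Require Import structures.
From mathcomp Require Import all_boot all_order all_algebra.
From mathcomp Require Import all_classical all_reals all_analysis.
From mathcomp Require Import ring lra.

Set Implicit Arguments.
Unset Strict Implicit.
Unset Printing Implicit Defensive.

Import Order.TTheory GRing.Theory Num.Theory.
Import numFieldNormedType.Exports.

Local Open Scope classical_set_scope.
Local Open Scope ring_scope.

(** The estimate is an energy argument: the first equation is tested with
    [kappa], the second with [X1 - X0].  The first terms of the two equations
    then agree up to the factor [dt], so that [dt] times the dissipation equals
    minus the sum of the two remaining terms of the second equation.  What is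
    left is a pointwise inequality, [energy_density_le]: these two terms
    dominate the increment of the length density.
    Writing [a] and [b] for the derivatives of [X1] and [X0], this combines two
    facts.  Convexity of [gp], used at [X1], and concavity of [gm], used at
    [X0], bound the increment of [sqrt g] by the gradient term; and
    Cauchy-Schwarz gives [a . (a - b) / |b| >= |a| (|a| - |b|) / |b|], which is
    at least [|a| - |b|] because [(|a| - |b|)^2 >= 0].

    The products are sums of one-sided limits at the nodes, so linearity and
    monotonicity of the lumped sum are only available for integrands that have
    such limits.  The one integrand for which this is not immediate contains
    the gradients of [gp] and [gm], which are only assumed to exist.  They
    are nevertheless continuous, because a differentiable convex function on an
    open set is continuously differentiable ([grad_continuous]).  Division by
    the speed of [X0] is legitimate because this speed is constant on each
    element, hence positive there as soon as it is positive almost everywhere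
    ([regular_speed]). *)

(** * Euclidean geometry of the plane *)

Section euclid.
Context {R : realType}.
Implicit Types u v w : 'rV[R]_2.

Lemma edotE u v : edot u v = u 0 0 * v 0 0 + u 0 1 * v 0 1.
Proof.
by rewrite /edot !big_ord_recl big_ord0 addr0; congr (_ + _ * _);
  congr (_ _ _); apply/val_inj.
Qed.

Lemma edotC u v : edot u v = edot v u.
Proof. by rewrite !edotE; ring. Qed.

Lemma edotDl u v w : edot (u + v) w = edot u w + edot v w.
Proof. by rewrite !edotE !mxE; ring. Qed.

Lemma edotNl u w : edot (- u) w = - edot u w.
Proof. by rewrite !edotE !mxE; ring. Qed.

Lemma edotZl (a : R) u w : edot (a *: u) w = a * edot u w.
Proof. by rewrite !edotE !mxE; ring. Qed.

Lemma edotDr u v w : edot w (u + v) = edot w u + edot w v.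
Proof. by rewrite !(edotC w) edotDl. Qed.

Lemma edotNr u w : edot w (- u) = - edot w u.
Proof. by rewrite !(edotC w) edotNl. Qed.

Lemma edotZr (a : R) u w : edot w (a *: u) = a * edot w u.
Proof. by rewrite !(edotC w) edotZl. Qed.

Lemma edot_ge0 u : 0 <= edot u u.
Proof. by rewrite edotE; nra. Qed.

Lemma enorm_ge0 u : 0 <= enorm u.
Proof. exact: sqrtr_ge0. Qed.

Lemma enorm_sqr u : enorm u ^+ 2 = edot u u.
Proof. by rewrite sqr_sqrtr// edot_ge0. Qed.

Lemma edot_le_enorm u v : edot u v <= enorm u * enorm v.
Proof.
rewrite /enorm -sqrtrM ?edot_ge0//; apply: le_trans (ler_norm _) _.
rewrite -sqrtr_sqr ler_wsqrtr// !edotE.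
set a := u 0 0; set b := u 0 1; set c := v 0 0; set d := v 0 1.
(* Lagrange's identity *)
rewrite -subr_ge0; have -> : (a * a + b * b) * (c * c + d * d) -
  (a * c + b * d) ^+ 2 = (a * d - b * c) ^+ 2 by ring.
exact: sqr_ge0.
Qed.

(** By Cauchy-Schwarz the right-hand side is at least
    [|u| (|u| - |v|) / |v|], which exceeds the left-hand side by
    [(|u| - |v|)^2 / |v|]. *)
Lemma stretch_ge u v : 0 < enorm v ->
  enorm u - enorm v <= edot u ((enorm v)^-1 *: (u - v)).
Proof.
move=> v0; rewrite edotZr edotDr edotNr -enorm_sqr -ler_pdivrMl ?invr_gt0//.
rewrite invrK; have := edot_le_enorm u v.
by have := sqr_ge0 (enorm u - enorm v); nra.
Qed.

Lemma cvg_rV (T : Type) (F : set_system T) {FF : Filter F} (u : T -> 'rV[R]_2)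
    (a : 'rV[R]_2) :
  (forall i, u x 0 i @[x --> F] --> a 0 i) -> u x @[x --> F] --> a.
Proof.
move=> ua; rewrite [a]row_sum_delta.
have -> : u = fun x => \sum_i u x 0 i *: delta_mx 0 i.
  by apply/funext => x; rewrite -row_sum_delta.
rewrite !big_ord_recl big_ord0 addr0.
under eq_fun do rewrite !big_ord_recl big_ord0 addr0.
by apply: cvgD; apply: cvgZr_tmp.
Qed.

Lemma cvg_edot (T : Type) (F : set_system T) {FF : Filter F}
    (u v : T -> 'rV[R]_2) a b :
  u x @[x --> F] --> a -> v x @[x --> F] --> b ->
  edot (u x) (v x) @[x --> F] --> edot a b.
Proof.
move=> ua vb; rewrite edotE; under eq_fun do rewrite edotE.
have coord (w : T -> 'rV[R]_2) (c : 'rV[R]_2) i : w x @[x --> F] --> c ->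
    w x 0 i @[x --> F] --> c 0 i.
  exact: (continuous_cvg _ (@coord_continuous _ _ _ 0 i c)).
by apply: cvgD; apply: cvgM; exact: coord.
Qed.

End euclid.

(** * Continuity of the gradient of a convex function *)

Section gradient.
Context {R : realType}.
Implicit Types (f : 'rV[R]_2 -> R) (H : set 'rV[R]_2).

Lemma gradN f z : differentiable f z -> grad (fun y => - f y) z = - grad f z.
Proof.
move=> fz; apply/rowP => i; rewrite !mxE -deriveN//.
exact: diff_derivable.
Qed.

Lemma edot_delta (u : 'rV[R]_2) i : edot u (delta_mx 0 i) = u 0 i.
Proof.
rewrite /edot (bigD1 i)//= big1 ?addr0 => [|j ji]; rewrite mxE ?eqxx ?mulr1//.
by rewrite (negPf ji) mulr0.
Qed.

(** Convexity traps each partial derivative at [w] between the difference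
    quotients of [f] at [w] with the fixed steps [r] and [- r].  For fixed [r]
    these quotients are continuous in [w], and for small [r] their values at
    [v] are close to the partial derivative at [v]. *)
Lemma grad_continuous H f v : open H -> (forall z, H z -> differentiable f z) ->
  convex_on H f -> H v -> {for v, continuous (grad f)}.
Proof.
move=> oH fd fc Hv; apply: (cvg_rV (F := nbhs v)) => i.
set e : 'rV[R]_2 := delta_mx 0 i.
pose Q (h : R) w := h^-1 * (f (h *: e + w) - f w).
have QD : Q h v @[h --> 0^'] --> grad f v 0 i.
  rewrite mxE; exact: (diff_derivable (fd _ Hv) : derivable f v e).
have shift_cvg (h : R) : (h *: e + w) @[w --> v] --> h *: e + v.
  by apply: (cvgD (F := nbhs v)); [exact: cvg_cst | exact: cvg_id].
have Hnear : \forall h \near 0^', H (h *: e + v).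
  have : (h *: e + v) @[h --> 0^'] --> 0 *: e + v.
    apply: cvgD; last exact: cvg_cst.
    by apply: cvgZr_tmp; exact: nbhs_dnbhs.
  by rewrite scale0r add0r; apply; exact: open_nbhs_nbhs.
have Qcvg h : H (h *: e + v) -> Q h w @[w --> v] --> Q h v.
  move=> Hh; apply: (cvgM (F := nbhs v)); first exact: cvg_cst.
  apply: (cvgB (F := nbhs v)); last exact/differentiable_continuous/fd.
  exact: (continuous_cvg _ (differentiable_continuous (fd _ Hh)) (shift_cvg h)).
have Qgrad h w : H w -> H (h *: e + w) ->
    h * grad f w 0 i <= f (h *: e + w) - f w.
  move=> Hw Hh; have := fc _ _ Hh Hw.
  by rewrite addrK edotZr edot_delta -lerBrDl.
have HnearW h : H (h *: e + v) -> \forall w \near v, H (h *: e + w).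
  by move=> Hh; apply: shift_cvg; exact: open_nbhs_nbhs.
have HW : \forall w \near v, H w by exact: open_nbhs_nbhs.
apply/cvgrPdist_lt => eps eps0.
have e2 : 0 < eps / 2 by rewrite divr_gt0.
have [r r0 rP] : exists2 r : R, 0 < r & forall h, `|h| = r ->
    H (h *: e + v) /\ `|grad f v 0 i - Q h v| < eps / 2.
  have: \forall h \near 0^', H (h *: e + v) /\ `|grad f v 0 i - Q h v| < eps / 2.
    by apply: filterI => //; move/cvgrPdist_lt: QD => /(_ _ e2).
  (* any radius strictly inside the punctured ball of radius d will do *)
  move=> [d /= d0 dP]; exists (d / 2); first by rewrite divr_gt0.
  move=> h hr; apply: dP.
    by rewrite /ball_/= sub0r normrN hr ltr_pdivrMr// ltr_pMr// ltr1n.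
  by rewrite -normr_gt0 hr divr_gt0.
have step h : `|h| = r -> \forall w \near v,
    [/\ H w, H (h *: e + w) & `|grad f v 0 i - Q h w| < eps].
  move=> /rP[Hh Qh].
  have : \forall w \near v, `|Q h v - Q h w| < eps / 2.
    by move/cvgrPdist_lt: (Qcvg _ Hh) => /(_ _ e2).
  move=> Qw; near=> w; split; [by near: w| by near: w; exact: HnearW|].
  rewrite [eps]splitr -(subrK (Q h v) (grad f v 0 i)) -addrA.
  apply: le_lt_trans (ler_normD _ _) _; apply: ltrD => //.
  by near: w.
have rr : `|r| = r by rewrite gtr0_norm.
have rN : `|- r| = r by rewrite normrN.
near=> w.
have [Hw H1 P1] : [/\ H w, H (r *: e + w) & `|grad f v 0 i - Q r w| < eps].
  by near: w; exact: step.
have [_ H2 P2] : [/\ H w, H (- r *: e + w) & `|grad f v 0 i - Q (- r) w| < eps].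
  by near: w; exact: step.
(* the step - r reverses the inequality, giving the bound from below *)
move: (Qgrad _ _ Hw H1) (Qgrad _ _ Hw H2).
have <- : r * Q r w = f (r *: e + w) - f w.
  by rewrite /Q mulVKf// gt_eqF.
have <- : - r * Q (- r) w = f (- r *: e + w) - f w.
  by rewrite /Q mulVKf// oppr_eq0 gt_eqF.
rewrite ler_pM2l// !mulNr lerN2 ler_pM2l// => u1 u2.
move: P1 P2; rewrite !ltr_norml => /andP[? ?] /andP[? ?].
by apply/andP; split; lra.
Unshelve. all: by end_near. Qed.

Lemma grad_continuous_concave H f v : open H ->
  (forall z, H z -> differentiable f z) -> convex_on H (fun z => - f z) -> H v ->
  {for v, continuous (grad f)}.
Proof.
move=> oH fd fc Hv.
have nfd y : H y -> differentiable (fun z => - f z) y.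
  by move=> Hy; apply: differentiableN; exact: fd.
have /(cvgN (F := nbhs v)) := grad_continuous oH nfd fc Hv.
rewrite gradN ?opprK; last exact: fd.
apply: cvg_trans; apply: (near_eq_cvg (F := nbhs v)); near=> y.
rewrite -[LHS]/(- grad (fun z => - f z) y) gradN ?opprK//; apply: fd.
by near: y; exact: open_nbhs_nbhs.
Unshelve. all: by end_near. Qed.

End gradient.

(** * Lumped sums as sums of limits inside the elements *)

Section elements.
Context {R : realType} (J : nat) (J_gt0 : (0 < J)%N).
Local Notation nd := (node R J).

Lemma node_lt j : nd j < nd j.+1.
Proof. by rewrite /node ltr_pM2r ?invr_gt0 ?ltr0n// ltr_nat. Qed.

Lemma node_ge0 j : 0 <= nd j.
Proof. by rewrite divr_ge0. Qed.

Lemma node_le1 j : (j <= J)%N -> nd j <= 1.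
Proof. by move=> jJ; rewrite /node ler_pdivrMr ?ltr0n// mul1r ler_nat. Qed.

(** [F] is a filter of approach to the node of index [i] from inside the
    element of index [j]; this treats the left and the right limits of the
    lumped sum together. *)
Definition element_end (j i : nat) (F : set_system R) : Prop :=
  [/\ (j < J)%N, (i <= J)%N, ProperFilter F, F --> nd i &
      \forall x \near F, x \in `]nd j, nd j.+1[].

Lemma element_end_left j : (j < J)%N -> element_end j j.+1 (nd j.+1)^'-.
Proof.
move=> jJ; split => //.
- exact: at_left_proper_filter.
- exact/cvg_at_left_filter/cvg_id.
- near=> x; rewrite in_itv/=; apply/andP; split; near: x.
    exact/nbhs_left_gt/node_lt.
  exact: nbhs_left_lt.
Unshelve. all: by end_near. Qed.

Lemma element_end_right j : (j < J)%N -> element_end j j (nd j)^'+.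
Proof.
move=> jJ; split => //; first exact: ltnW.
- exact: at_right_proper_filter.
- exact/cvg_at_right_filter/cvg_id.
- near=> x; rewrite in_itv/=; apply/andP; split; near: x.
    exact: nbhs_right_gt.
  exact/nbhs_right_lt/node_lt.
Unshelve. all: by end_near. Qed.

Definition lumpable (w : R -> R) : Prop :=
  forall j i F, element_end j i F -> cvg (w x @[x --> F]).

Lemma lumpableD u v : lumpable u -> lumpable v -> lumpable (u \+ v).
Proof.
by move=> lu lv j i F E; have [_ _ PF _ _] := E; apply: is_cvgD; eauto.
Qed.

Lemma lumpedD u v : lumpable u -> lumpable v ->
  lumped J (u \+ v) = lumped J u + lumped J v.
Proof.
move=> lu lv; rewrite /lumped -[RHS]mulrDr -big_split/=; apply: (congr1 ( *%R _)).
apply: eq_bigr => j _; rewrite -mulrDr addrACA; congr (_ * (_ + _)).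
- by apply: limD; [exact: lu (element_end_left (ltn_ord j))
                  | exact: lv (element_end_left (ltn_ord j))].
- by apply: limD; [exact: lu (element_end_right (ltn_ord j))
                  | exact: lv (element_end_right (ltn_ord j))].
Qed.

Lemma lumpedZ (c : R) u : lumpable u ->
  lumped J (fun x => c * u x) = c * lumped J u.
Proof.
move=> lu; rewrite /lumped [RHS]mulrCA; congr (_ * _); rewrite mulr_sumr.
apply: eq_bigr => j _; rewrite [RHS]mulrCA [X in _ = _ * X]mulrDr.
congr (_ * (_ + _)).
- apply: cvg_lim => //; apply: cvgM; first exact: cvg_cst.
  exact: lu (element_end_left (ltn_ord j)).
- apply: cvg_lim => //; apply: cvgM; first exact: cvg_cst.
  exact: lu (element_end_right (ltn_ord j)).
Qed.

Lemma lumped_le u v : lumpable u -> lumpable v ->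
  (forall j i F, element_end j i F -> \forall x \near F, u x <= v x) ->
  lumped J u <= lumped J v.
Proof.
move=> lu lv uv; rewrite ler_pM2l ?invr_gt0//; apply: ler_sum => j _.
rewrite ler_pM2l ?invr_gt0 ?ltr0n//.
have El := element_end_left (ltn_ord j).
have Er := element_end_right (ltn_ord j).
by apply: lerD; apply: ler_lim; [apply: lu El | apply: lv El | apply: uv El
  | apply: lu Er | apply: lv Er | apply: uv Er].
Qed.

(** * Piecewise affine curves *)

Lemma near_const_cvg (T : Type) (U : topologicalType) (F : set_system T)
    {FF : Filter F} (u : T -> U) c :
  (\forall x \near F, u x = c) -> u x @[x --> F] --> c.
Proof.
move=> uc; apply: cvg_trans (cvg_cst (F := F) c); apply: near_eq_cvg.
by apply: filterS uc => x ->.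
Qed.

Lemma derive1_affine (V : normedModType R) (X : R -> V) (A B : V) (a b x : R) :
  {in `[a, b], forall y, X y = A + y *: B} -> x \in `]a, b[ ->
  derive1 X x = B.
Proof.
move=> XE xab; rewrite derive1E.
have -> : 'D_1 X x = 'D_1 (fun y : R => A + y *: B) x.
  apply: near_eq_derive; near=> y; apply: XE.
  apply: subset_itv_oo_cc; near: y; exact: near_in_itvoo.
apply/cvg_lim; first exact: norm_hausdorff.
apply: near_const_cvg; near=> h => /=.
rewrite opprD addrACA subrr add0r -scalerBl addrK -[h *: 1]/(h * 1) mulr1.
rewrite scalerA mulVf ?scale1r//.
near: h; exact: nbhs_dnbhs_neq.
Unshelve. all: by end_near. Qed.

Lemma Vh2_affine X j : Vh2 J X -> (j < J)%N ->
  exists A B, {in `[nd j, nd j.+1], forall x, X x = A + x *: B}.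
Proof.
move=> XV jJ.
have /fin_all_exists[a /fin_all_exists[b ab]] : forall i : 'I_2, exists a b : R,
    {in `[nd j, nd j.+1], forall x, X x 0 i = a + b * x}.
  by move=> i; have [_ _ /(_ _ jJ)] := XV i.
exists (\row_i a i), (\row_i b i) => x xj; apply/rowP => i.
by rewrite !mxE (ab i)// mulrC.
Qed.

Lemma Vh2_derive1 X j : Vh2 J X -> (j < J)%N ->
  exists B, forall x, x \in `]nd j, nd j.+1[ -> derive1 X x = B.
Proof.
move=> XV jJ; have [A [B XE]] := Vh2_affine XV jJ.
by exists B => x; exact: derive1_affine XE.
Qed.

Lemma VhB (u v : R -> R) : Vh J u -> Vh J v -> Vh J (fun x => u x - v x).
Proof.
move=> [pu cu au] [pv cv av]; split.
- by move=> x; rewrite pu pv.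
- by move=> x; apply: cvgB; [exact: cu | exact: cv].
- move=> j jJ; have [a [b ub]] := au _ jJ; have [c [d vd]] := av _ jJ.
  by exists (a - c), (b - d) => x xj; rewrite ub// vd//; ring.
Qed.

Lemma Vh2B (X Y : R -> 'rV[R]_2) : Vh2 J X -> Vh2 J Y ->
  Vh2 J (fun x => X x - Y x).
Proof.
move=> VX VY i; have := VhB (VX i) (VY i).
by congr (Vh J); apply/funext => x; rewrite !mxE.
Qed.

Lemma Vh2_derive1B (X Y : R -> 'rV[R]_2) j x : Vh2 J X -> Vh2 J Y -> (j < J)%N ->
  x \in `]nd j, nd j.+1[ ->
  derive1 (fun y => X y - Y y) x = derive1 X x - derive1 Y x.
Proof.
move=> VX VY jJ xj; have [A [B XE]] := Vh2_affine VX jJ.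
have [C [D YE]] := Vh2_affine VY jJ.
rewrite (derive1_affine XE xj) (derive1_affine YE xj).
apply: (@derive1_affine _ _ (A - C) (B - D)) xj => y yj.
by rewrite XE// YE// scalerBr opprD addrACA.
Qed.

Lemma Vh2_continuous (X : R -> 'rV[R]_2) : Vh2 J X -> continuous X.
Proof.
move=> VX x; apply: (cvg_rV (F := nbhs x)) => i.
by have [_ /(_ x) + _] := VX i.
Qed.

(** The node of index 0 is the node of index [J] up to a period. *)
Lemma Vh2_nodes (X : R -> 'rV[R]_2) (H : set 'rV[R]_2) : Vh2 J X ->
  (forall j, (1 <= j <= J)%N -> H (X (nd j))) ->
  forall j, (j <= J)%N -> H (X (nd j)).
Proof.
move=> VX XH [_|j jJ]; last exact: XH.
have -> : X (nd 0) = X (nd J).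
  apply/rowP => i; have [per _ _] := VX i.
  by rewrite -per /node mul0r add0r divff// pnatr_eq0 -lt0n.
by apply: XH; rewrite J_gt0 leqnn.
Qed.

Lemma Vh2_end_cvg (X : R -> 'rV[R]_2) j i F : Vh2 J X -> element_end j i F ->
  X x @[x --> F] --> X (nd i).
Proof.
move=> /Vh2_continuous Xc [_ _ PF Fi _]; exact: continuous_cvg (Xc _) Fi.
Qed.

Lemma Vh2_comp_cvg (U : topologicalType) (f : 'rV[R]_2 -> U)
    (H : set 'rV[R]_2) (X : R -> 'rV[R]_2) j i F :
  (forall z, H z -> {for z, continuous f}) -> Vh2 J X ->
  (forall k, (1 <= k <= J)%N -> H (X (nd k))) -> element_end j i F ->
  f (X x) @[x --> F] --> f (X (nd i)).
Proof.
move=> fc XV XH E; have [_ iJ PF _ _] := E.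
exact: (continuous_cvg _ (fc _ (Vh2_nodes XV XH iJ)) (Vh2_end_cvg XV E)).
Qed.

Lemma Vh2_derive1_cvg (U : topologicalType) (f : 'rV[R]_2 -> U)
    (X : R -> 'rV[R]_2) j i F : Vh2 J X -> element_end j i F ->
  exists l : U, f (derive1 X x) @[x --> F] --> l.
Proof.
move=> XV [jJ _ PF _ Fj]; have [B XB] := Vh2_derive1 XV jJ.
exists (f B); apply: near_const_cvg.
by apply: filterS Fj => x /XB ->.
Qed.

(** The speed is constant on the open element, which has positive measure, so
    it cannot vanish there. *)
Lemma regular_speed X j x :
  {ae (@lebesgue_measure R), forall x, x \in `[0%R, 1%R] -> 0 < speed X x} ->
  Vh2 J X -> (j < J)%N -> x \in `]nd j, nd j.+1[ -> 0 < speed X x.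
Proof.
move=> reg VX jJ xj; rewrite ltNge; apply/negP => sx.
have [B XB] := Vh2_derive1 VX jJ.
have : (@lebesgue_measure R).-negligible `]nd j, nd j.+1[%classic.
  apply: negligibleS reg => y /= yj imp.
  have : 0 < speed X y.
    apply: imp; move: yj; rewrite !in_itv/= => /andP[y1 y2].
    rewrite (le_trans (node_ge0 j) (ltW y1))/=.
    exact: le_trans (ltW y2) (node_le1 jJ).
  by rewrite /speed (XB y yj) -(XB x xj) ltNge sx.
move/negligibleP => /(_ (measurable_itv _)) /eqP.
rewrite /= lebesgue_measure_itv/= lte_fin node_lt -EFinB eqe.
by rewrite subr_eq0 gt_eqF// node_lt.
Qed.

End elements.

(** * The energy estimate *)

(** The increment splits as
    [(sqrt (g z1) - sqrt (g z0)) |a| + sqrt (g z0) (|a| - |b|)].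
    The first summand is bounded through the splitting of [sqrt g], taking the
    gradient of the convex part at the new point and that of the concave part
    at the old one; the second one is bounded by [stretch_ge]. *)
Lemma energy_density_le (R : realType) (H : set 'rV[R]_2)
    (g gp gm : 'rV[R]_2 -> R) (z0 z1 a b : 'rV[R]_2) :
  (forall z, H z -> Num.sqrt (g z) = gp z + gm z) ->
  (forall z, H z -> differentiable gm z) ->
  convex_on H gp -> convex_on H (fun z => - gm z) ->
  H z0 -> H z1 -> 0 < enorm b ->
  Num.sqrt (g z1) * enorm a <= Num.sqrt (g z0) * enorm b
    + (edot (grad gp z1 + grad gm z0) (enorm a *: (z1 - z0))
       + edot (Num.sqrt (g z0) *: a) ((enorm b)^-1 *: (a - b))).
Proof.
move=> g_split gm_diff gp_conv gm_conc H0 H1 b0.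
have := gp_conv _ _ H0 H1; have := gm_conc _ _ H1 H0.
rewrite gradN; last exact: gm_diff.
rewrite -(opprB z1 z0) edotNr edotNl !edotZr edotDl edotZl.
set p := edot (grad gp z1) _; set q := edot (grad gm z0) _ => gmz gpz.
have sz : Num.sqrt (g z1) - Num.sqrt (g z0) <= p + q.
  by rewrite !g_split//; lra.
have := ler_wpM2r (enorm_ge0 a) sz.
have := ler_wpM2l (sqrtr_ge0 (g z0)) (stretch_ge a b0).
rewrite edotZr; lra.
Qed.

Theorem theorem3p10 (R : realType) (H : set 'rV[R]_2) (g gp gm : 'rV[R]_2 -> R)
  (J M : nat) (T : R) (t : nat -> R) (m : nat)
  (X0 X1 : R -> 'rV[R]_2) (kappa : R -> R)
  (H_open : open H)
  (g_smooth : smooth_on H g)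
  (g_pos : forall z, H z -> 0 < g z)
  (g_split : forall z, H z -> Num.sqrt (g z) = gp z + gm z)
  (gp_diff : forall z, H z -> differentiable gp z)
  (gm_diff : forall z, H z -> differentiable gm z)
  (gp_convex : convex_on H gp)
  (gm_concave : convex_on H (fun z => - gm z))
  (J_ge3 : (3 <= J)%N)
  (t_start : t 0%N = 0)
  (t_incr : forall i, (i < M)%N -> t i < t i.+1)
  (t_end : t M = T)
  (m_lt : (m < M)%N)
  (X0_Vh : Vh2 J X0)
  (X0_H : forall j, (1 <= j <= J)%N -> H (X0 (node R J j)))
  (X0_reg : {ae (@lebesgue_measure R), forall x, x \in `[0%R, 1%R] -> 0 < speed X0 x})
  (X1_Vh : Vh2 J X1)
  (kappa_Vh : Vh J kappa)
  (X1_H : forall j, (1 <= j <= J)%N -> H (X1 (node R J j)))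
  (eq_motion : scheme_motion J g (t m.+1 - t m) X0 X1 kappa)
  (eq_curvature : scheme_curvature J g gp gm X0 X1 kappa) :
  Lgh J g X1
  + (t m.+1 - t m) * mlip J (fun x => (Num.sqrt (g (X0 x)))^-1 * `|derive1 kappa x| ^+ 2)
                            (fun x => (speed X0 x)^-1)
  <= Lgh J g X0.
Proof.
have J_gt0 : (0 < J)%N by exact: leq_trans J_ge3.
have dt_gt0 : 0 < t m.+1 - t m by rewrite subr_gt0 t_incr.
set dt := t m.+1 - t m in dt_gt0 eq_motion *.
pose eta x := X1 x - X0 x.
have eta_Vh : Vh2 J eta by exact: Vh2B.
(* the three terms of the curvature equation tested with eta *)
pose C1 x := edot ((g (X0 x) * kappa x) *: normal X0 x) (speed X0 x *: eta x).
pose C2 x := edot (grad gp (X1 x) + grad gm (X0 x)) (speed X1 x *: eta x).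
pose C3 x := edot (Num.sqrt (g (X0 x)) *: derive1 X1 x)
                  ((speed X0 x)^-1 *: derive1 eta x).
pose L (X : R -> 'rV[R]_2) x := Num.sqrt (g (X x)) * speed X x.
have g_cont z : H z -> {for z, continuous g} by exact: (g_smooth 0%N).
have sqrtg_cont z : H z -> {for z, continuous (fun z => Num.sqrt (g z))}.
  move=> /g_cont gz; apply: continuous_comp gz _; exact: sqrt_continuous.
have gp_cont z : H z -> {for z, continuous (grad gp)}.
  exact: (grad_continuous H_open gp_diff gp_convex).
have gm_cont z : H z -> {for z, continuous (grad gm)}.
  exact: (grad_continuous_concave H_open gm_diff gm_concave).
have L_lump X : Vh2 J X ->
    (forall j, (1 <= j <= J)%N -> H (X (node R J j))) -> lumpable J (L X).
  move=> XV XH j i F E; have [_ _ PF _ _] := E.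
  have [s sX] := Vh2_derive1_cvg (@enorm R) XV E.
  apply/cvg_ex; eexists; apply: cvgM sX.
  exact: (Vh2_comp_cvg J_gt0 sqrtg_cont XV XH E).
have C1_lump : lumpable J C1.
  move=> j i F E; have [_ _ PF Fi _] := E.
  have [_ /(_ (node R J i)) kc _] := kappa_Vh.
  have [n n_cvg] :=
    Vh2_derive1_cvg (fun b => - ((enorm b)^-1 *: perp b)) X0_Vh E.
  have [s s_cvg] := Vh2_derive1_cvg (@enorm R) X0_Vh E.
  apply/cvg_ex; eexists; apply: cvg_edot; apply: cvgZ.
  - apply: cvgM; first exact: (Vh2_comp_cvg J_gt0 g_cont X0_Vh X0_H E).
    exact: (continuous_cvg _ kc Fi).
  - exact: n_cvg.
  - exact: s_cvg.
  - exact: (Vh2_end_cvg eta_Vh E).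
have C2_lump : lumpable J C2.
  move=> j i F E; have [_ _ PF _ _] := E.
  have [s s_cvg] := Vh2_derive1_cvg (@enorm R) X1_Vh E.
  apply/cvg_ex; eexists; apply: cvg_edot; [apply: cvgD|apply: cvgZ].
  - exact: (Vh2_comp_cvg J_gt0 gp_cont X1_Vh X1_H E).
  - exact: (Vh2_comp_cvg J_gt0 gm_cont X0_Vh X0_H E).
  - exact: s_cvg.
  - exact: (Vh2_end_cvg eta_Vh E).
have C3_lump : lumpable J C3.
  move=> j i F E; have [_ _ PF _ _] := E.
  have [a a_cvg] := Vh2_derive1_cvg id X1_Vh E.
  have [s s_cvg] := Vh2_derive1_cvg (fun b => (enorm b)^-1) X0_Vh E.
  have [e e_cvg] := Vh2_derive1_cvg id eta_Vh E.
  apply/cvg_ex; eexists; apply: cvg_edot; apply: cvgZ.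
  - exact: (Vh2_comp_cvg J_gt0 sqrtg_cont X0_Vh X0_H E).
  - exact: a_cvg.
  - exact: s_cvg.
  - exact: e_cvg.
have motion : dt * mlip J
    (fun x => (Num.sqrt (g (X0 x)))^-1 * `|derive1 kappa x| ^+ 2)
    (fun x => (speed X0 x)^-1) = lumped J C1.
  have -> : mlip J (fun x => (Num.sqrt (g (X0 x)))^-1 * `|derive1 kappa x| ^+ 2)
      (fun x => (speed X0 x)^-1) =
    mlip J (fun x => (Num.sqrt (g (X0 x)))^-1 * derive1 kappa x)
      (fun x => derive1 kappa x * (speed X0 x)^-1).
    congr (lumped J); apply/funext => x.
    by rewrite real_normK ?num_real// expr2 !mulrA.
  rewrite -eq_motion//; set M1 := mlipv _ _ _.
  have -> : M1 = lumped J (fun x => dt^-1 * C1 x).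
    congr (lumped J); apply/funext => x; rewrite /C1.
    by rewrite !(edotZl, edotZr) (edotC (normal _ _)); ring.
  by rewrite (lumpedZ J_gt0)// mulVKf// gt_eqF.
have curvature : lumped J C1 + lumped J C2 + lumped J C3 = 0.
  exact: eq_curvature.
have C1E : lumped J C1 = - (lumped J C2 + lumped J C3).
  by apply/eqP; rewrite -addr_eq0 addrA curvature.
rewrite (etrans motion C1E) lerBlDr.
have C23_lump : lumpable J (C2 \+ C3) by exact: lumpableD.
have L0_lump : lumpable J (L X0) by exact: L_lump.
suff : lumped J (L X1) <= lumped J (L X0 \+ (C2 \+ C3)).
  rewrite (lumpedD J_gt0 L0_lump C23_lump) (lumpedD J_gt0 C2_lump C3_lump).
  exact.
apply: lumped_le; [exact: J_gt0|exact: L_lump|exact: lumpableD|].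
move=> j i F E; have [jJ iJ PF Fi Fj] := E; near=> x.
have xj : x \in `]node R J j, node R J j.+1[ by near: x.
rewrite /= /L /C2 /C3 (Vh2_derive1B X1_Vh X0_Vh jJ xj).
apply: (energy_density_le _ g_split gm_diff gp_convex gm_concave).
- near: x; apply: (Vh2_end_cvg X0_Vh E); apply: open_nbhs_nbhs; split => //.
  exact: (Vh2_nodes J_gt0 X0_Vh X0_H iJ).
- near: x; apply: (Vh2_end_cvg X1_Vh E); apply: open_nbhs_nbhs; split => //.
  exact: (Vh2_nodes J_gt0 X1_Vh X1_H iJ).
- exact: (regular_speed J_gt0 X0_reg X0_Vh jJ xj).
Unshelve. all: by end_near. Qed.
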